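(* For $n\ge 1$, let $g_n(\lambda)$ be the characteristic polynomial of the $n\times n$ matrix $G_n$ whose $(p,q)$ entry is $2^{q-p+1}$ if $q\ge p$, $2$ if $q=p-1$, and $0$ if $q<p-1$; and let $g_0(\lambda)=1$. Then for all $n\ge 1$, $$g_{n}(\lambda) = (2-\lambda)g_{n-1}(\lambda) + \sum_{i=2}^{n}(-1)^{i+1}2^{2i-1}g_{n-i}(\lambda).$$
   Context: The characteristic polynomial of an $n\times n$ matrix $G_n$ is $\det(G_n-\lambda I)$. Empty sums are $0$. *)

(* Defs.v *)
From HB Require Import structures.
From mathcomp Require Import all_boot all_order all_algebra.

Set Implicit Arguments.
Unset Strict Implicit.
Unset Printing Implicit Defensive.

Import GRing.Theory.
Local Open Scope ring_scope.

(* Indices start at 0; since both are shifted by one, [q - p + 1] and the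
   comparisons of [q] with [p] and [p - 1] are those of 1-based indexing. *)
Definition Gmx (R : comNzRingType) (n : nat) : 'M[R]_n :=
  \matrix_(p < n, q < n)
    (if (p <= q)%N then 2 ^+ (q - p + 1)
     else if (q.+1 == p)%N then 2 else 0).

(* The convention is det(A - lambda I), which differs from MathComp's
   [char_poly], i.e. det(lambda I - A), by the factor (-1)^n. *)
Definition charpoly (R : comNzRingType) (n : nat) (A : 'M[R]_n) : {poly R} :=
  \det (map_mx polyC A - 'X%:M).

Definition g (R : comNzRingType) (n : nat) : {poly R} :=
  if n is 0 then 1 else charpoly (Gmx R n).

(* Main.v *)
Require Import Defs.
From HB Require Import structures.
From mathcomp Require Import all_boot all_order all_algebra.

Set Implicit Arguments.
Unset Strict Implicit.
Unset Printing Implicit Defensive.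

Import GRing.Theory.
Local Open Scope ring_scope.

(** [charpoly (Gmx R n)] is the determinant of an upper Hessenberg Toeplitz
    matrix.  Replacing its first row by an arbitrary sequence [b] gives a family
    closed under expansion along the first column: the minor at row 0 is the
    Toeplitz matrix again, and the minor at row 1 is the same matrix with [b]
    shifted by one.  Iterating yields the recurrence. *)

Definition toepl_hess (S : comNzRingType) (a : nat -> S) (c : S) (n : nat) :
    'M[S]_n :=
  \matrix_(i < n, j < n)
    (if (i <= j)%N then a (j - i)%N else if (j.+1 == i)%N then c else 0).

Definition toepl_hess_row0 (S : comNzRingType) (a : nat -> S) (c : S)
    (b : nat -> S) (n : nat) : 'M[S]_n :=
  \matrix_(i < n, j < n) (if i == 0%N :> nat then b j else toepl_hess a c n i j).

Lemma toepl_hess_row0_id (S : comNzRingType) (a : nat -> S) (c : S) n :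
  toepl_hess_row0 a c a n = toepl_hess a c n.
Proof.
by apply/matrixP=> i j; rewrite !mxE; case: eqP => // ->; rewrite subn0.
Qed.

Lemma det_toepl_hess_row0_rec (S : comNzRingType) (a : nat -> S) (c : S)
    (b : nat -> S) n :
  \det (toepl_hess_row0 a c b n.+2) =
    b 0%N * \det (toepl_hess a c n.+1)
    - c * \det (toepl_hess_row0 a c (fun k => b k.+1) n.+1).
Proof.
rewrite (expand_det_col _ ord0) big_ord_recl big_ord_recl big1 => [|i _].
  rewrite addr0 !mxE /= /cofactor /= expr0 expr1 mul1r mulN1r mulrN.
  congr (_ * _ - _ * _); congr (\det _); apply/matrixP=> i j; rewrite !mxE //=.
  (* Deleting row 1 keeps row 0 in place and shifts every later row by one, hence the case split on
     [i]. *)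
  by case: i => [[|i] //= lti].
by rewrite !mxE /= mul0r.
Qed.

(** Each unrolling of the recursion contributes a factor [- c] and shifts [b], so the induction
    keeps [b] general. *)
Lemma det_toepl_hess_row0 (S : comNzRingType) (a : nat -> S) (c : S) n
    (b : nat -> S) :
  \det (toepl_hess_row0 a c b n.+1) =
    \sum_(k < n.+1) (- c) ^+ k * b k * \det (toepl_hess a c (n - k)).
Proof.
elim: n b => [|n IHn] b.
  by rewrite det_mx11 big_ord1 !mxE /= det_mx00 mul1r mulr1.
rewrite det_toepl_hess_row0_rec IHn [RHS]big_ord_recl mul1r subn0; congr (_ + _).
rewrite -mulNr mulr_sumr; apply: eq_bigr => k _.
by rewrite exprS !mulrA.
Qed.

(** Subtracting ['X] along the diagonal keeps the matrix Toeplitz: only the value at offset 0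
    changes. *)
Lemma g_toepl_hess (R : comNzRingType) n :
  g R n = \det (toepl_hess (fun k => if k is 0 then 2 - 'X else 2 ^+ k.+1) 2 n).
Proof.
case: n => [|n]; first by rewrite det_mx00.
congr (\det _); apply/matrixP=> i j; rewrite !mxE -val_eqE /=.
case: ltngtP => [ltij|ltji|->].
- by rewrite subr0 addn1 polyC_exp polyC_natr -(subnSK ltij).
- by case: eqP => _; rewrite subr0 ?polyC_natr.
- by rewrite subnn expr1 polyC_natr.
Qed.

Theorem corollary3 (R : comNzRingType) (n : nat) (hn : (1 <= n)%N) :
  g R n = (2 - 'X) * g R (n - 1)
          + \sum_(2 <= i < n.+1)
              (-1) ^+ (i + 1) * 2 ^+ (2 * i - 1) * g R (n - i).
Proof.
case: n hn => // n _.
rewrite [LHS]g_toepl_hess -toepl_hess_row0_id det_toepl_hess_row0 big_ord_recl.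
rewrite mul1r subn0 subn1 -g_toepl_hess; congr (_ + _).
(* Term [k.+1] of the expansion is the summand [i = k.+2]: its coefficient is
   [(-2)^(k+1) 2^(k+2) = (-1)^(k+1) 2^(2k+3)], and [2k+3 = 2i-1]. *)
rewrite big_add1 big_add1 big_mkord; apply: eq_bigr => k _.
rewrite -g_toepl_hess subSS; congr (_ * _).
rewrite (_ : _ ^+ (k.+2 + 1) = (-1) ^+ k.+1).
  rewrite lift0 [LHS]/= [(-2) ^+ _]exprNn -mulrA -exprD.
  by congr (_ * _ ^+ _); rewrite mul2n -addnn !addSn !addnS subn1.
by rewrite addn1 exprS mulN1r exprS mulN1r opprK.
Qed.
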